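(* Let $n\in\mathbb{N}$ and $1\le k\le n$. For a generic pair $(L,a)$, where $L:\mathbb{R}^n\to\mathbb{R}^k$ is a surjective linear map and $a\in\mathbb{R}^k$, the $k$-boundary $\mathcal{H}_L^k(a)$ of the hyperbolic slice $\mathcal{H}_L(a)$ is finite. In particular, a generic hyperbolic slice has only finitely many local extreme points. The number of those points is bounded by $$\min\left\{2^{n-k}\frac{(n-1)!}{(k-1)!},\ \binom{n}{k}\frac{(n-1)!}{(k-1)!}\right\}.$$
   Context: For $z\in\mathbb{R}^n$ let $f_z:=T^n-z_1T^{n-1}+\dots+(-1)^nz_n\in\mathbb{R}[T]$. Let $\mathcal{H}:=\{z\in\mathbb{R}^n : f_z \text{ has only real roots}\}$ and, for $1\le m\le n$, let $\mathcal{H}^m:=\{z\in\mathcal{H} : f_z\text{ has at most } m \text{ distinct roots}\}$. The hyperbolic slice associated with $L$ and $a$ is $\mathcal{H}_L(a):=\mathcal{H}\cap L^{-1}(a)$, and $\mathcal{H}_L^m(a):=\mathcal{H}^m\cap L^{-1}(a)$ is its $m$-boundary. For $A\subseteq\mathbb{R}^n$, a point $z\in A$ is a local extreme point of $A$ if there is a neighborhood $U\subseteq\mathbb{R}^n$ of $z$ such that $z$ is an extreme point of $\operatorname{conv}(A\cap U)$. ''Generic'' has its usual meaning: the property holds for all $(L,a)\in\operatorname{Hom}(\mathbb{R}^n,\mathbb{R}^k)\times\mathbb{R}^k$ outside some proper algebraic subset (depending only on $n$ and $k$). *)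

(* Defs.v *)
From HB Require Import structures.
From mathcomp Require Import all_boot all_order all_algebra.
From mathcomp Require Import complex.
From mathcomp Require Import all_classical all_reals all_analysis.
(* mpoly is not imported because its notations clash with those of analysis. *)
From mathcomp Require mpoly.
Set Implicit Arguments.
Unset Strict Implicit.
Unset Printing Implicit Defensive.
Import Order.TTheory GRing.Theory Num.Theory.
Import numFieldNormedType.Exports.

Local Open Scope classical_set_scope.
Local Open Scope card_scope.
Local Open Scope ring_scope.

Section Hyperbolic.
Variables (R : realType) (n : nat).
Implicit Type z : 'rV[R]_n.

(* The coordinate z_(i+1) of the mathematics is z 0 i, with i : 'I_n. *)
Definition fpoly z : {poly R} :=
  'X^n + \sum_(i < n) ((-1) ^+ i.+1 * z 0 i) *: 'X^(n - i.+1).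

Definition only_real_roots (p : {poly R}) : Prop :=
  forall w : complex R,
    root (map_poly (real_complex R) p) w -> complex.Im w = 0.

Definition hyperbolic : set 'rV[R]_n := [set z | only_real_roots (fpoly z)].

Definition hyperbolic_stratum (m : nat) : set 'rV[R]_n :=
  hyperbolic `&` [set z | [set x : R | root (fpoly z) x] #<= `I_m].

Variable k : nat.
Implicit Types (L : {linear 'rV[R]_n -> 'rV[R]_k}) (a : 'rV[R]_k).

Definition hyperbolic_slice L a : set 'rV[R]_n :=
  hyperbolic `&` (L @^-1` [set a]).

Definition slice_boundary (m : nat) L a : set 'rV[R]_n :=
  hyperbolic_stratum m `&` (L @^-1` [set a]).

End Hyperbolic.

Section Extreme.
Variables (R : realType) (n : nat).
Implicit Types (A C : set 'rV[R]_n) (z : 'rV[R]_n).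

Definition convex_hull A : set 'rV[R]_n :=
  smallest (@convex_set R 'rV[R]_n) A.

Definition extreme_point C z : Prop :=
  C z /\
  forall x y (t : R), C x -> C y -> 0 < t -> t < 1 ->
    z = t *: x + (1 - t) *: y -> x = z /\ y = z.

Definition local_extreme_points A : set 'rV[R]_n :=
  [set z | A z /\
    exists U : set 'rV[R]_n, nbhs z U /\ extreme_point (convex_hull (A `&` U)) z].

End Extreme.

Section Generic.
Variable R : realType.

Definition algebraic_subset (N : nat) (V : set 'rV[R]_N) : Prop :=
  exists S : set (mpoly.mpoly N R),
    V = [set v | forall p, S p -> mpoly.meval (fun i => v 0 i) p = 0].

Variables n k : nat.

(* Coordinates on Hom(R^n, R^k) x R^k: the entries of the matrix of L,
   followed by those of a. *)
Definition pair_coord (L : {linear 'rV[R]_n -> 'rV[R]_k}) (a : 'rV[R]_k) :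
  'rV[R]_(n * k + k) := row_mx (mxvec (lin1_mx L)) a.

Definition generically
    (P : {linear 'rV[R]_n -> 'rV[R]_k} -> 'rV[R]_k -> Prop) : Prop :=
  exists V : set 'rV[R]_(n * k + k),
    [/\ algebraic_subset V, V <> setT &
        forall L a, ~ V (pair_coord L a) -> P L a].

End Generic.

(* Main.v *)
(** Every [fpoly z] with [z] in the k-boundary lies in one of the sets
    [{ \prod_i g_i ^+ i : deg g_i = c_i }] with [\sum_i c_i = k] and
    [\sum_i i * c_i = n].  Since a coefficient of [g ^+ i] is a form of degree
    [i] in the coefficients of [g], the polynomials of degree [s] restrict to
    their union [X] as a space of dimension at most [a * (s + C) ^ k / k!],
    where [a] is the coefficient of [T ^ n] in [(\sum_m m T ^ m) ^ k], that is
    ['C(n + k - 1, 2k - 1)], which is below both bounds of the theorem.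

    A set [X] with such a Hilbert function meets a generic slice [L z = a'] in
    at most [a] points.  For a linear form [theta], the products
    [(L z) ^ beta * theta ^ i] with [|beta| <= s] and [i <= a] are more numerous
    than the dimension of the space of functions on [X] in which they live, so
    they satisfy a nontrivial relation whose coefficients are polynomials in
    [L].  Evaluating at [L z = a'] gives a polynomial equation of degree at most
    [a] for [theta] on the slice, and finitely many choices of [theta] suffice
    to separate any [a + 1] points.

    A local extreme point is in the k-boundary: if [fpoly z = g * h] with [g]
    squarefree of degree [d > k], the directions [q * h] with [deg q < d]
    preserve hyperbolicity to both sides, and by dimension one of them lies in
    the kernel of [L]. *)

Require Import Defs.
From mathcomp Require Import all_boot all_order all_algebra.
From mathcomp Require Import all_classical all_reals all_analysis.
From mathcomp Require Import complex.
From mathcomp Require polyrcf.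
From mathcomp Require Import ring lra zify.
From mathcomp Require mpoly.
Import -(notations) mpoly.
Set Implicit Arguments.
Unset Strict Implicit.
Unset Printing Implicit Defensive.
Import Order.TTheory GRing.Theory Num.Theory.
Import numFieldNormedType.Exports.
Local Open Scope classical_set_scope.
Local Open Scope card_scope.
Local Open Scope ring_scope.

(** * Multivariate polynomials *)

Lemma horner_muni (R : comNzRingType) (n : nat) (p : mpoly n.+1 R)
    (v : 'I_n.+1 -> R) :
  (map_poly (meval (v \o widen_ord (leqnSn n))) (muni p)).[v ord_max] =
  meval v p.
Proof.
rewrite muniE rmorph_sum /= horner_sum mevalE; apply: eq_bigr => m _.
rewrite map_polyZ /= mevalZ mevalX map_polyXn hornerZ hornerXn -mulrA.
congr (_ * _); rewrite big_ord_recr /=; congr (_ * _).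
by apply: eq_bigr => i _; rewrite mnmE.
Qed.

(** [muni] only regroups terms by the exponent of the last variable: the coefficient of [p] at [m0]
    survives, at the truncated monomial, inside the coefficient of degree [m0 ord_max]. *)
Lemma muni_eq0 (R : nzRingType) (n : nat) (p : mpoly n.+1 R) :
  muni p = 0 -> p = 0.
Proof.
move=> p0; apply/mpolyP => m0; rewrite mcoeff0.
have := congr1 (fun q : {poly mpoly n R} => mcoeff
  (Multinom [tuple m0 (widen_ord (leqnSn n) i) | i < n]) q`_(m0 ord_max)) p0.
rewrite muniE coef0 mcoeff0 coef_sum raddf_sum /= => <-.
have coefE m : mcoeff (Multinom [tuple m0 (widen_ord (leqnSn n) i) | i < n])
    ((mcoeff m p *: mpolyX R
      (Multinom [tuple m (widen_ord (leqnSn n) i) | i < n])) *: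
        'X^(m ord_max))`_(m0 ord_max) = mcoeff m p * (m == m0)%:R.
  rewrite coefZ coefXn -scalerAl mcoeffZ; congr (_ * _).
  have [mm|mm] := eqVneq (m0 ord_max) (m ord_max); last first.
    by rewrite mulr0 mcoeff0; case: eqVneq => // e; rewrite e eqxx in mm.
  rewrite mulr1 mcoeffX; congr (_ %:R); congr nat_of_bool; apply/eqP/eqP => [e|->//].
  apply/mnmP => i; have [j ->|->] := unliftP ord_max i; last by rewrite mm.
  have -> : lift ord_max j = widen_ord (leqnSn n) j.
    by apply/val_inj; rewrite /= /bump leqNgt ltn_ord.
  by have := congr1 (fun m : multinom n => m j) e; rewrite !mnmE.
rewrite (eq_bigr _ (fun m _ => coefE m)).
have [m0p|m0p] := boolP (m0 \in msupp p).
  rewrite (bigD1_seq m0) ?msupp_uniq //= eqxx mulr1 big1 ?addr0 //.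
  by move=> m /negbTE ->; rewrite mulr0.
rewrite big1_seq ?(memN_msupp_eq0 m0p) // => m /andP[_ mp].
by case: eqVneq => [e|]; rewrite ?mulr0 //; rewrite e (negbTE m0p) in mp.
Qed.

Lemma poly_neq0_nat_ex (R : numDomainType) (p : {poly R}) (N : nat) :
  p != 0 -> (size p <= N)%N -> exists2 x : nat, (x < N)%N & p.[x%:R] != 0.
Proof.
move=> p0 sp; have [//|h] := pselect (exists2 x : nat, (x < N)%N & p.[x%:R] != 0).
suff : (size [seq i%:R : R | i <- iota 0 N] < size p)%N.
  by rewrite size_map size_iota ltnNge sp.
apply: max_poly_roots => //; last first.
  by rewrite map_inj_uniq ?iota_uniq // => i j /eqP; rewrite eqr_nat => /eqP.
rewrite all_map; apply/allP => i; rewrite mem_iota /= add0n => iN.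
by apply/negPn/negP => ri; apply: h; exists i.
Qed.

(** Induction on the number of variables: make the leading coefficient in the last variable nonzero,
    then avoid the finitely many roots. Indexing points by [nat] lets the same function serve for
    every number of variables. *)
Lemma meval_neq0_ex (R : numDomainType) (n : nat) (p : mpoly n R) :
  p != 0 -> exists v : nat -> R, meval (fun i => v i) p != 0.
Proof.
elim: n p => [|n IHn] p p0.
  exists (fun=> 0); move: p0; apply: contraNN; rewrite mevalE => /eqP h.
  apply/eqP/mpolyP => m; rewrite mcoeff0.
  have e0 m' : m' = m :> multinom 0 by apply/mnmP => -[].
  have [mp|mp] := boolP (m \in msupp p); last by rewrite memN_msupp_eq0.
  rewrite -[RHS]h (bigD1_seq m) ?msupp_uniq //= big_ord0 mulr1 big1 ?addr0 // => m'.
  by rewrite (e0 m') eqxx.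
have q0 : muni p != 0 by apply: contra_neq p0; apply: muni_eq0.
have [v vP] := IHn _ (eq_ind_r (fun b => ~~ b) q0 (lead_coef_eq0 (muni p))).
pose q := map_poly (meval (fun i : 'I_n => v i)) (muni p).
have : q != 0.
  by apply: contraNneq vP => q00; rewrite lead_coefE -coef_map -/q q00 coef0.
move=> /poly_neq0_nat_ex /(_ (leqnn _)) [x _ qx].
pose w (i : nat) := if (i < n)%N then v i else x%:R.
exists w; rewrite -horner_muni /w /= ltnn; move: qx; rewrite /q.
congr (_.[_] != 0); congr (map_poly _ _).
by apply: funext => r; apply: meval_eq => i /=; rewrite ltn_ord.
Qed.

(** Fraction-free Gaussian elimination. With a polynomial ring as [D], it yields relations that are
    polynomial in the parameters. *)
Lemma ex_linear_dependence_ord (D : idomainType) (H p : nat)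
    (w : 'I_p -> nat -> D) :
  (H < p)%N ->
  exists2 P : 'I_p -> D, exists i, P i != 0 &
    forall h, (h < H)%N -> \sum_i P i * w i h = 0.
Proof.
elim: H p w => [|H IHH] [//|p] w Hp.
  by exists (fun=> 1) => //; exists ord0; rewrite oner_neq0.
have [/existsP[i0 a0]|/existsPn w0] := boolP [exists i, w i H != 0]; last first.
  have [P P0 PH] := IHH p.+1 w (ltnW Hp); exists P => // h.
  rewrite ltnS leq_eqVlt => /orP[/eqP ->|]; last exact: PH.
  by rewrite big1 // => i _; rewrite (eqP (negPn (w0 i))) mulr0.
(* Cross-multiplication with the pivot [w i0 H] eliminates the unknown [i0]. Scaling the other
   unknowns by the pivot makes equation [H] solvable for [P i0] without division. *)
pose w' (j : 'I_p) h := w i0 H * w (lift i0 j) h - w (lift i0 j) H * w i0 h.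
have [P' [j0 P'0] P'H] := IHH p w' Hp.
pose P i := if unlift i0 i is Some j then P' j * w i0 H
            else - \sum_j P' j * w (lift i0 j) H.
have Pl j : P (lift i0 j) = P' j * w i0 H by rewrite /P liftK.
have Pi0 : P i0 = - \sum_j P' j * w (lift i0 j) H by rewrite /P unlift_none.
exists P => [|h hH]; first by exists (lift i0 j0); rewrite Pl mulf_neq0.
rewrite (bigD1_ord i0) //= Pi0 mulNr mulr_suml.
under [X in _ + X]eq_bigr do rewrite Pl.
rewrite addrC -sumrB.
have [->|hH'] := eqVneq h H.
  by rewrite big1 // => j _; rewrite -!mulrA [w i0 H * _]mulrC subrr.
rewrite -[RHS](P'H h); last by rewrite ltn_neqAle hH' -ltnS.
by apply: eq_bigr => j _; rewrite /w' mulrBr !mulrA.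
Qed.

Lemma ex_linear_dependence (D : idomainType) (I : finType) (H : nat)
    (w : I -> 'I_H -> D) :
  (H < #|I|)%N ->
  exists2 P : I -> D, exists i, P i != 0 & forall h, \sum_i P i * w i h = 0.
Proof.
pose w' (i : 'I_#|I|) h := if insub h is Some h' then w (enum_val i) h' else 0.
move=> /(ex_linear_dependence_ord w')[P [i0 P0] PH].
exists (P \o enum_rank) => [|h].
  by exists (enum_val i0); rewrite /= enum_valK.
rewrite -[RHS](PH h (ltn_ord h)) (reindex (@enum_val I I)) /=; last first.
  by apply: onW_bij; apply: enum_val_bij.
apply: eq_bigr => i _; rewrite enum_valK /w' insubT //= => hH.
by congr (_ * w _ _); apply: val_inj.
Qed.

(** * Generic linear slices *)

Section Bezout.
Variables (R : realType) (n k d H : nat) (X : set 'rV[R]_n).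
Variable b : 'I_H -> 'rV[R]_n -> R.
Hypothesis bP : forall l : seq 'I_n, (size l <= d)%N ->
  exists c : 'I_H -> R, forall z, X z -> \prod_(j <- l) z 0 j = \sum_h c h * b h z.

(** Multiplying out one form at a time moves its coordinates into [l]. With [b] fixed, the
    coefficients stay polynomial in the parameters [v], so a dependence among such products can be
    sought over that polynomial ring. *)
Lemma prod_linear_forms_spanned (N : nat) (F : seq ('I_n -> mpoly N R))
    (l : seq 'I_n) :
  (size F + size l <= d)%N ->
  exists w : 'I_H -> mpoly N R, forall v z, X z ->
    (\prod_(f <- F) \sum_i meval v (f i) * z 0 i) * \prod_(j <- l) z 0 j =
    \sum_h meval v (w h) * b h z.
Proof.
elim: F l => [|f F IHF] l sd.
  have [c cP] := bP sd; exists (fun h => mpolyC N (c h)) => v z Xz.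
  by rewrite big_nil mul1r cP //; apply: eq_bigr => h _; rewrite mevalC.
have : forall i, exists w : 'I_H -> mpoly N R, forall v z, X z ->
    (\prod_(f <- F) \sum_i meval v (f i) * z 0 i) * \prod_(j <- i :: l) z 0 j =
    \sum_h meval v (w h) * b h z by move=> i; apply: IHF; rewrite /= addnS.
move=> /choice[w wP].
exists (fun h => \sum_i f i * w i h) => v z Xz.
rewrite big_cons mulr_suml mulr_suml.
transitivity (\sum_i meval v (f i) * \sum_h meval v (w i h) * b h z).
  apply: eq_bigr => i _; rewrite -wP // big_cons; ring.
under eq_bigr do rewrite mulr_sumr.
rewrite exchange_big /=; apply: eq_bigr => h _; rewrite raddf_sum mulr_suml /=.
by apply: eq_bigr => i _; rewrite mevalM mulrA.
Qed.

Lemma slice_moment_relation (s M : nat) (u : R) :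
  d = (s + M)%N -> (H < M.+1 * 'C(k + s, k))%N ->
  exists2 Q : 'I_M.+1 -> mpoly (n * k + k) R, exists i, Q i != 0 &
    forall (A : 'M[R]_(n, k)) z, X z ->
      \sum_i meval (row_mx (mxvec A) (z *m A) 0) (Q i) *
        (\sum_(j < n) u ^+ j * z 0 j) ^+ i = 0.
Proof.
move=> dE HM.
pose B := {t : k.-tuple 'I_s.+1 | (\sum_(i <- t) i <= s)%N}.
have cardB : #|{: 'I_M.+1 * B}| = (M.+1 * 'C(k + s, k))%N.
  rewrite card_prod card_ord; congr (_ * _)%N.
  rewrite card_sig -card_partial_ord_partitions.
  by apply: eq_card => t; rewrite !inE.
(* [F (i, t)] lists the factors of [theta ^ i] times the monomial with exponents [t] in [z *m A].
   The entries of [A] are variables, while [theta] has constant coefficients. *)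
pose theta (i : 'I_n) : mpoly (n * k) R := mpolyC _ (u ^+ i).
pose lin (j : 'I_k) (i : 'I_n) : mpoly (n * k) R := mpolyX R (mnm1 (mxvec_index i j)).
pose F (it : 'I_M.+1 * B) := nseq it.1 theta ++
  flatten [seq nseq (tnth (sval it.2) j) (lin j) | j <- enum 'I_k].
have sF it : (size (F it) + size (@nil 'I_n) <= d)%N.
  case: it => i [t ts]; rewrite dE addn0 size_cat size_nseq addnC leq_add ?leq_ord //.
  rewrite size_flatten /shape sumnE -map_comp big_map big_enum /=.
  rewrite big_tuple in ts; apply: leq_trans ts; apply: leq_sum => j _.
  by rewrite size_nseq.
have /choice[w wP] it := prod_linear_forms_spanned (sF it).
have [|P [[i0 t0] P0] PH] := @ex_linear_dependence _ ('I_M.+1 * B)%type H w.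
  by rewrite cardB.
(* The relation is regrouped by powers of [theta], and the coordinates of [z *m A] become the last
   [k] variables. *)
pose Q i : mpoly (n * k + k) R := \sum_(t : B)
  comp_mpoly [tuple mpolyX R (mnm1 (lshift k l)) | l < n * k] (P (i, t)) *
  \prod_(j < k) mpolyX R (mnm1 (rshift (n * k) j)) ^+ tnth (sval t) j.
have QE i (v : 'rV_(n * k)) (a : 'rV_k) : meval (row_mx v a 0) (Q i) =
    \sum_(t : B) meval (v 0) (P (i, t)) * \prod_(j < k) a 0 j ^+ tnth (sval t) j.
  rewrite raddf_sum /=; apply: eq_bigr => t _.
  rewrite mevalM comp_mpoly_meval rmorph_prod /=; congr (_ * _).
    by apply: meval_eq => l; rewrite tnth_mktuple mevalXU row_mxEl.
  by apply: eq_bigr => j _; rewrite rmorphXn /= mevalXU row_mxEr.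
exists Q.
  have [v vP] := meval_neq0_ex P0.
  (* Once the entries of [A] are specialized so that [P (i0, t0)] stays nonzero, distinct [t] give
     distinct monomials in the last [k] variables, so nothing cancels. *)
  pose q : mpoly k R := \sum_(t : B) meval (fun i => v i) (P (i0, t)) *:
    mpolyX R (Multinom [tuple nat_of_ord (tnth (sval t) j) | j < k]).
  have q0 : q != 0.
    apply: contraNneq vP => /(congr1 (mcoeff
      (Multinom [tuple nat_of_ord (tnth (sval t0) j) | j < k]))).
    rewrite mcoeff0 raddf_sum /= (bigD1 t0) //= mcoeffZ mcoeffX eqxx mulr1.
    rewrite big1 ?addr0 => [->//|t tt0]; rewrite mcoeffZ mcoeffX.
    case: eqVneq => [e|]; last by rewrite mulr0.
    case/eqP: tt0; apply/val_inj/eq_from_tnth => j; apply/val_inj.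
    by have := congr1 (fun m : multinom k => m j) e; rewrite !mnmE.
  have [a aP] := meval_neq0_ex q0.
  exists i0; apply: contraNneq aP => Q0.
  have := QE i0 (\row_i v i) (\row_j a j); rewrite Q0 meval0 => e.
  rewrite [X in X == _](_ : _ = 0) // [RHS]e raddf_sum /=; apply: eq_bigr => t _.
  rewrite /= mevalZ mevalX; congr (_ * _); first by apply: meval_eq => i; rewrite mxE.
  by apply: eq_bigr => j _; rewrite mnmE mxE.
move=> A z Xz.
transitivity (\sum_(it : 'I_M.+1 * B) meval (mxvec A 0) (P it) *
    \sum_h meval (mxvec A 0) (w it h) * b h z).
  transitivity (\sum_i \sum_(t : B) meval (mxvec A 0) (P (i, t)) *
      \sum_h meval (mxvec A 0) (w (i, t) h) * b h z); last first.
    by rewrite pair_bigA; apply: eq_bigr => -[].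
  apply: eq_bigr => i _; rewrite QE mulr_suml; apply: eq_bigr => t _.
  rewrite -mulrA; congr (_ * _); rewrite -wP // big_nil mulr1 /F big_cat mulrC.
  congr (_ * _).
    rewrite big_nseq iter_mulr_1; congr (_ ^+ _).
    by apply: eq_bigr => j _; rewrite mevalC.
  rewrite big_flatten big_map big_enum; apply: eq_bigr => j _ /=.
  rewrite big_nseq iter_mulr_1; congr (_ ^+ _).
  by rewrite mxE; apply: eq_bigr => l _; rewrite mevalXU mxvecE mulrC.
under eq_bigr do rewrite mulr_sumr.
rewrite exchange_big big1 //= => h _.
under eq_bigr do rewrite mulrA.
rewrite -mulr_suml; under eq_bigr do rewrite -mevalM.
by rewrite -raddf_sum PH raddf0 mul0r.
Qed.
End Bezout.

(** For two distinct vectors, equality of the forms is a nontrivial polynomial equation in [u] of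
    degree below [n]. The bound on [u] depends only on [n] and the number of points, so finitely
    many [u] serve all slices. *)
Lemma moment_form_injective_ex (R : numDomainType) (n : nat) (zs : seq 'rV[R]_n) :
  exists2 u : nat, (u <= size zs * size zs * n)%N &
    {in zs &, injective (fun z : 'rV[R]_n => \sum_(j < n) u%:R ^+ j * z 0 j)}.
Proof.
pose ps := [seq p <- [seq (x, y) | x <- zs, y <- zs] | p.1 != p.2].
pose P := \prod_(p <- ps) rVpoly (p.1 - p.2).
have P0 : P != 0.
  rewrite /P prodf_seq_neq0; apply/allP => -[x y]; rewrite mem_filter => /andP[/= xy _].
  apply: contra_neq xy => /(congr1 (@poly_rV R n)).
  by rewrite rVpolyK linear0 => /eqP; rewrite subr_eq0 => /eqP.
have sP : (size P <= (size zs * size zs * n).+1)%N.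
  have sz : (size ps <= size zs * size zs)%N.
    by rewrite size_filter (leq_trans (count_size _ _)) // size_allpairs.
  apply: (@leq_trans (size ps * n).+1); last by rewrite ltnS leq_mul2r sz orbT.
  rewrite /P; elim: ps {sz P0 P} => [|p ps IH]; first by rewrite big_nil size_poly1.
  rewrite big_cons (leq_trans (size_polyMleq _ _)) //= mulSn.
  have := size_poly n (fun k => if insub k is Some i then (p.1 - p.2) 0 i else 0).
  rewrite -/(rVpoly (p.1 - p.2)) => h; move: IH h.
  move: (size (rVpoly _)) (size _) (size ps * n)%N => a c e; lia.
have [u uN Pu] := poly_neq0_nat_ex P0 sP.
exists u => // x y xs ys exy; apply/eqP; apply: contraNT Pu => xy.
have xyp : (x, y) \in ps.
  by rewrite mem_filter /= xy; apply/allpairsP; exists (x, y).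
rewrite /P (big_rem _ xyp) /= hornerM (horner_coef_wide _ (size_poly _ _)).
rewrite (eq_bigr (fun i : 'I_n => u%:R ^+ i * x 0 i - u%:R ^+ i * y 0 i)).
  by rewrite sumrB exy subrr mul0r.
by move=> i _; rewrite coef_rVpoly_ord !mxE; ring.
Qed.

Lemma generic_slice_card (R : realType) (n k s M H : nat) (X : set 'rV[R]_n)
    (b : 'I_H -> 'rV[R]_n -> R) :
  (forall l : seq 'I_n, (size l <= s + M)%N ->
    exists c : 'I_H -> R,
      forall z, X z -> \prod_(j <- l) z 0 j = \sum_h c h * b h z) ->
  (H < M.+1 * 'C(k + s, k))%N ->
  exists2 q : mpoly (n * k + k) R, q != 0 &
    forall (A : 'M[R]_(n, k)) a, meval (row_mx (mxvec A) a 0) q != 0 ->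
      forall zs, uniq zs -> (forall z, z \in zs -> X z /\ z *m A = a) ->
      (size zs <= M)%N.
Proof.
move=> bP HM.
have : forall u : nat, exists Qi : ('I_M.+1 -> mpoly (n * k + k) R) * 'I_M.+1,
    Qi.1 Qi.2 != 0 /\ forall (A : 'M[R]_(n, k)) z, X z ->
      \sum_i meval (row_mx (mxvec A) (z *m A) 0) (Qi.1 i) *
        (\sum_(j < n) u%:R ^+ j * z 0 j) ^+ i = 0.
  move=> u; have [Q [i Qi] QE] := slice_moment_relation bP u%:R erefl HM.
  by exists (Q, i).
move=> /choice[Qi /all_and2[Qi0 QiE]].
(* For each [u] that [M.+1] points may call for, one nonzero coefficient of its relation must not
   vanish at the slice. *)
exists (\prod_(u < (M.+1 * M.+1 * n).+1) (Qi u).1 (Qi u).2).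
  by apply/prodf_neq0 => u _.
move=> A a qa zs uzs zsP; rewrite leqNgt; apply/negP => Mzs.
pose ys := take M.+1 zs.
have sys : size ys = M.+1 by rewrite size_takel.
have uys : uniq ys by rewrite take_uniq.
have [u uN uinj] := moment_form_injective_ex ys.
rewrite sys -ltnS in uN.
move: qa; rewrite rmorph_prod /= => /prodf_neq0/(_ (Ordinal uN) isT) /=.
have := QiE u A; case: (Qi u) => Q i /= QE Qi_neq0.
(* This is the equation of degree at most [M] for [theta] on the slice; the points of [ys] would
   give it [M.+1] distinct roots. *)
pose p := \poly_(i < M.+1) meval (row_mx (mxvec A) a 0) (Q (inord i)).
have p0 : p != 0.
  apply: contraNneq Qi_neq0 => /(congr1 (fun p : {poly R} => p`_i)).
  by rewrite coef0 coef_poly ltn_ord inord_val => ->.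
pose theta (z : 'rV[R]_n) := \sum_(j < n) u%:R ^+ j * z 0 j.
have : (size (map theta ys) < size p)%N.
  apply: max_poly_roots => //; last by rewrite map_inj_in_uniq.
  rewrite all_map; apply/allP => z /mem_take/zsP[Xz za] /=.
  rewrite rootE horner_poly -[X in _ == X](QE z Xz) za; apply/eqP.
  by apply: eq_bigr => j _; rewrite inord_val.
by rewrite size_map sys ltnNge size_poly.
Qed.

(** * Hilbert functions of sets of polynomials *)

Section Hilbert.
Variable R : realType.

Definition spanned (T : Type) (I : finType) (X : set T) (b : I -> T -> R)
    (phi : T -> R) :=
  exists c : I -> R, forall x, X x -> phi x = \sum_i c i * b i x.

Lemma spanned_sum (T : Type) (I J : finType) (X : set T) (b : I -> T -> R)
    (phi : J -> T -> R) :
  (forall j, spanned X b (phi j)) -> spanned X b (fun x => \sum_j phi j x).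
Proof.
move=> /choice[c cP]; exists (fun i => \sum_j c j i) => x Xx.
under [LHS]eq_bigr do rewrite cP //.
by rewrite exchange_big; apply: eq_bigr => i _; rewrite mulr_suml.
Qed.

Lemma spannedZ (T : Type) (I : finType) (X : set T) (b : I -> T -> R)
    (a : R) (phi : T -> R) :
  spanned X b phi -> spanned X b (fun x => a * phi x).
Proof.
move=> [c cP]; exists (fun i => a * c i) => x Xx.
by rewrite cP // mulr_sumr; apply: eq_bigr => i _; rewrite mulrA.
Qed.

Lemma eq_spanned (T : Type) (I : finType) (X : set T) (b : I -> T -> R)
    (phi psi : T -> R) :
  (forall x, X x -> psi x = phi x) -> spanned X b phi -> spanned X b psi.
Proof. by move=> e [c cP]; exists c => x Xx; rewrite e ?cP. Qed.

(* The affine Hilbert function of [X] at [s] is at most [a * (s + C) ^ k / k!].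
   Working with [s]-fold products of coefficients covers all degrees at most
   [s] when [X] consists of monic polynomials of the same degree. *)
Definition hilbert_bounded (X : set {poly R}) (k a : nat) := exists C, forall s,
  exists (I : finType) (b : I -> {poly R} -> R),
    (k`! * #|I| <= a * (s + C) ^ k)%N /\
    forall l : seq nat, size l = s ->
      spanned X b (fun f => \prod_(j <- l) f`_j).

Definition monics (c : nat) : set {poly R} :=
  [set f | f \is monic /\ size f = c.+1].

Definition powers (i : nat) (X : set {poly R}) : set {poly R} :=
  [set f | exists2 g, X g & f = g ^+ i].

Definition products (X Y : set {poly R}) : set {poly R} :=
  [set f | exists g h, [/\ X g, Y h & f = g * h]].

Lemma prod_seq_count (c : nat) (F : nat -> R) (l : seq nat) :
  all (fun j => j < c)%N l ->
  \prod_(j <- l) F j = \prod_(j < c) F j ^+ count_mem (nat_of_ord j) l.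
Proof.
elim: l => [_|i l IHl /= /andP[ic /IHl{}IHl]]; first by rewrite big_nil big1.
rewrite big_cons IHl (bigD1 (Ordinal ic)) // [RHS](bigD1 (Ordinal ic)) //=.
rewrite eqxx exprS mulrA; congr (_ * _); apply: eq_bigr => j ji.
by rewrite (_ : (i == j) = false) //; apply: contraNF ji => /eqP e; apply/eqP/val_inj.
Qed.

Lemma ffact_leq_expn (n m : nat) : (n ^_ m <= n ^ m)%N.
Proof.
elim: m n => [|m IHm] [|n] //.
rewrite ffactSS expnS leq_mul2l (leq_trans (IHm n)) ?orbT //.
by case: m {IHm} => // m; rewrite leq_exp2r.
Qed.

Lemma expn_leq_ffact (s k : nat) : (s.+1 ^ k <= (k + s) ^_ k)%N.
Proof.
elim: k => // k IHk; rewrite addSn ffactSS expnS leq_mul //.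
by rewrite ltnS leq_addl.
Qed.

Lemma sum_count_mem_leq (c : nat) (l : seq nat) :
  (\sum_(j < c) count_mem (nat_of_ord j) l <= size l)%N.
Proof.
elim: l => [|i l IHl] /=; first by rewrite big1.
rewrite big_split /= -add1n leq_add //.
have [ic|ci] := ltnP i c; last first.
  by rewrite big1 // => j _; rewrite gtn_eqF // (leq_trans (ltn_ord j)).
rewrite (bigD1 (Ordinal ic)) //= eqxx big1 // => j ji.
by rewrite (_ : (i == j) = false) //; apply: contraNF ji => /eqP e; apply/eqP/val_inj.
Qed.

(** Only [c] coefficients are free and the leading one is 1, so a product of [s] coefficients is
    zero or a monomial of degree at most [s] in [c] variables. *)
Lemma hilbert_monics (c : nat) : hilbert_bounded (monics c) c 1.
Proof.
exists c => s.
pose B := {t : c.-tuple 'I_s.+1 | (\sum_(i <- t) i <= s)%N}.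
exists B, (fun (t : B) (f : {poly R}) => \prod_(j < c) f`_j ^+ tnth (sval t) j); split.
  have -> : #|{: B}| = 'C(c + s, c).
    rewrite card_sig -card_partial_ord_partitions.
    by apply: eq_card => t; rewrite !inE.
  by rewrite mul1n mulnC bin_ffact addnC ffact_leq_expn.
move=> l sl; have [lc|lc] := boolP (all (fun j => j < c.+1)%N l); last first.
  exists (fun=> 0) => f [_ sf]; rewrite [RHS]big1 => [|i _]; last by rewrite mul0r.
  move: lc; rewrite -has_predC => /hasP[j jl /=]; rewrite -leqNgt => cj.
  by rewrite (big_rem _ jl) /= nth_default ?mul0r // sf.
have cl j : (count_mem j l < s.+1)%N by rewrite ltnS -sl count_size.
pose t0 := [tuple Ordinal (cl (nat_of_ord j)) | j < c].
have t0P : (\sum_(i <- t0) i <= s)%N.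
  rewrite big_tuple; apply: (@leq_trans (size l)); last by rewrite sl.
  apply: leq_trans (sum_count_mem_leq c l).
  by apply: leq_sum => j _; rewrite tnth_mktuple.
exists (fun t => (t == exist _ t0 t0P)%:R) => f [f1 sf].
rewrite (bigD1 (exist _ t0 t0P)) //= eqxx mul1r [X in _ + X]big1 ?addr0; last first.
  by move=> t /negbTE ->; rewrite mul0r.
rewrite (prod_seq_count _ lc) big_ord_recr /=.
have -> : f`_c = 1 by move/monicP: f1; rewrite lead_coefE sf.
by rewrite expr1n mulr1; apply: eq_bigr => j _; rewrite tnth_mktuple.
Qed.

Lemma hilbert_powers (X : set {poly R}) (k a i : nat) : (0 < i)%N ->
  hilbert_bounded X k a -> hilbert_bounded (powers i X) k (a * i ^ k).
Proof.
move=> i0 [C XP]; exists C => s; have [I [b [cI bP]]] := XP (i * s)%N.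
(* The functions for degree [s] are those of [X] for degree [i * s], evaluated at a chosen [i]-th
   root in [X]. *)
pose root_of (f : {poly R}) := xget 0 [set g | X g /\ f = g ^+ i].
have rootP f : powers i X f -> X (root_of f) /\ f = root_of f ^+ i.
  by move=> [g Xg ->]; apply: (@xgetPex _ 0 [set h | X h /\ g ^+ i = h ^+ i]); exists g.
exists I, (fun j f => b j (root_of f)); split.
  rewrite (leq_trans cI) // -mulnA leq_mul2l -expnMn; apply/orP; right.
  by case: k {XP cI} => // k; rewrite leq_exp2r // mulnDr leq_add2l leq_pmull.
(* [l] holds the coefficients of [g ^+ i] still to expand and [p] the coefficients of [g] already
   produced; the total degree in the latter stays exactly [i * s]. *)
suff bPi l p : (size p + i * size l)%N = (i * s)%N ->
    spanned X b (fun g => \prod_(j <- l) (g ^+ i)`_j * \prod_(j <- p) g`_j).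
  move=> l sl; have [|c cP] := bPi l [::]; first by rewrite sl.
  exists c => f /rootP[Xg {1}->]; rewrite -cP // big_nil mulr1.
  by apply: eq_bigr.
elim: l p => [p sp|j l IHl p /= sp].
  rewrite muln0 addn0 in sp; apply: eq_spanned (bP p sp) => g _.
  by rewrite big_nil mul1r.
suff h e j' q : (e + size q + i * size l)%N = (i * s)%N -> spanned X b (fun g =>
    (g ^+ e)`_j' * (\prod_(j <- l) (g ^+ i)`_j * \prod_(j <- q) g`_j)).
  apply: eq_spanned (h i j p _) => [g _|]; first by rewrite big_cons mulrA.
  by rewrite -sp mulnS; lia.
elim: e j' q => [|e IHe] j' q sq.
  apply: eq_spanned (spannedZ (j' == 0)%:R (IHl q sq)) => g _.
  by rewrite expr0 coef1.
have h (m : 'I_j'.+1) : spanned X b (fun g => (g ^+ e)`_(j' - m) *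
    (\prod_(j <- l) (g ^+ i)`_j * \prod_(j <- (nat_of_ord m :: q)) g`_j)).
  by apply: IHe; rewrite -sq /=; lia.
apply: eq_spanned (spanned_sum h) => g _.
rewrite exprS coefM mulr_suml; apply: eq_bigr => m _; rewrite big_cons; ring.
Qed.

(** Coefficients of a product are bilinear in those of the factors, so pairwise products of the two
    spanning families suffice. The binomial compensates for the normalization by [k!]. *)
Lemma hilbert_products (X Y : set {poly R}) (k1 k2 a1 a2 : nat) :
  hilbert_bounded X k1 a1 -> hilbert_bounded Y k2 a2 ->
  hilbert_bounded (products X Y) (k1 + k2) ('C(k1 + k2, k1) * a1 * a2).
Proof.
move=> [C1 XP] [C2 YP]; exists (maxn C1 C2) => s.
have [I [b [cI bP]]] := XP s; have [J [d [cJ dP]]] := YP s.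
pose fac (f : {poly R}) :=
  xget (0, 0) [set gh | [/\ X gh.1, Y gh.2 & f = gh.1 * gh.2]].
have facP f : products X Y f ->
    [/\ X (fac f).1, Y (fac f).2 & f = (fac f).1 * (fac f).2].
  move=> [g [h [Xg Yh ->]]].
  apply: (@xgetPex _ (0, 0) [set x | [/\ X x.1, Y x.2 & g * h = x.1 * x.2]]).
  by exists (g, h).
exists (I * J)%type, (fun ij f => b ij.1 (fac f).1 * d ij.2 (fac f).2); split.
  rewrite card_prod -(bin_fact (leq_addr k2 k1)) addKn.
  have h C k : (C <= maxn C1 C2 -> (s + C) ^ k <= (s + maxn C1 C2) ^ k)%N.
    by case: k => // k CC; rewrite leq_exp2r // leq_add2l.
  have := leq_mul (leq_trans cI (leq_mul (leqnn a1) (h _ k1 (leq_maxl _ _))))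
    (leq_trans cJ (leq_mul (leqnn a2) (h _ k2 (leq_maxr _ _)))).
  rewrite expnD; move: (_ ^ k1)%N (_ ^ k2)%N 'C(k1 + k2, k1) => x y z hh.
  apply: (@leq_trans (z * ((k1`! * #|I|) * (k2`! * #|J|)))%N).
    by apply: eq_leq; ring.
  by apply: (leq_trans (leq_mul (leqnn z) hh)); apply: eq_leq; ring.
pose XY : set ({poly R} * {poly R}) := [set x | X x.1 /\ Y x.2].
pose bd (ij : I * J) (x : {poly R} * {poly R}) := b ij.1 x.1 * d ij.2 x.2.
(* Each coefficient of [x.1 * x.2] that leaves [l] adds one entry to [p] and one to [q], so both end
   with length [s]. *)
suff h l p q : (size p + size l)%N = s -> (size q + size l)%N = s ->
    spanned XY bd (fun x => \prod_(j <- l) (x.1 * x.2)`_j *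
      (\prod_(j <- p) x.1`_j * \prod_(j <- q) x.2`_j)).
  move=> l sl; have [//|//|c cP] := h l [::] [::].
  exists c => f /facP[Xf Yf fE]; rewrite -(cP (fac f)) // !big_nil !mulr1.
  by apply: eq_bigr => j _; rewrite -fE.
elim: l p q => [|j l IHl] p q /= sp sq.
  rewrite addn0 in sp; rewrite addn0 in sq.
  have [u uP] := bP p sp; have [v vP] := dP q sq.
  exists (fun ij => u ij.1 * v ij.2) => x [Xx Yx].
  rewrite big_nil mul1r uP // vP // mulr_suml.
  under eq_bigr do rewrite mulr_sumr.
  by rewrite pair_bigA; apply: eq_bigr => -[i m] _ /=; rewrite /bd /=; ring.
have h (m : 'I_j.+1) : spanned XY bd (fun x => \prod_(j <- l) (x.1 * x.2)`_j *
    (\prod_(j <- (nat_of_ord m :: p)) x.1`_j * \prod_(j <- ((j - m)%N :: q)) x.2`_j)).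
  by apply: IHl; rewrite /= addSnnS.
apply: eq_spanned (spanned_sum h) => x _.
rewrite big_cons coefM -mulrA mulr_suml; apply: eq_bigr => m _.
rewrite !big_cons; ring.
Qed.

Lemma hilbert_set0 (k : nat) : hilbert_bounded set0 k 0.
Proof.
exists 0 => s; exists 'I_0, (fun _ _ => 0); split; first by rewrite card_ord muln0.
by move=> l _; exists (fun=> 0).
Qed.

(** The spanning functions are arbitrary functions, so each family can be cut off by zero outside
    its own part of the union. *)
Lemma hilbert_setU (X Y : set {poly R}) (k a1 a2 : nat) :
  hilbert_bounded X k a1 -> hilbert_bounded Y k a2 ->
  hilbert_bounded (X `|` Y) k (a1 + a2).
Proof.
move=> [C1 XP] [C2 YP]; exists (maxn C1 C2) => s.
have [I [b [cI bP]]] := XP s; have [J [d [cJ dP]]] := YP s.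
exists (I + J)%type, (fun ij f => match ij with
  | inl i => (if `[< X f >] then b i f else 0)
  | inr j => (if `[< X f >] then 0 else d j f) end); split.
  rewrite card_sum mulnDr mulnDl leq_add //.
    rewrite (leq_trans cI) // leq_mul //.
    by case: k {XP YP cI cJ} => // k; rewrite leq_exp2r // leq_add2l leq_maxl.
  rewrite (leq_trans cJ) // leq_mul //.
  by case: k {XP YP cI cJ} => // k; rewrite leq_exp2r // leq_add2l leq_maxr.
move=> l sl; have [u uP] := bP l sl; have [v vP] := dP l sl.
exists (fun ij => match ij with inl i => u i | inr j => v j end) => f XYf.
rewrite big_sumType /=; case: asboolP => Xf /=.
  by rewrite uP // [X in _ + X]big1 ?addr0 // => j _; rewrite mulr0.
rewrite [X in X + _]big1 ?add0r => [|i _]; last by rewrite mulr0.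
by case: XYf => // Yf; rewrite vP.
Qed.

End Hilbert.

(** * Strata of polynomials with few distinct roots *)

(* Products [g_1 ^+ 1 * ... * g_i ^+ i] of degree [n] with monic [g_j] whose
   degrees add up to [k]; the [g_j] may have common or multiple roots. *)
Fixpoint strata (R : realType) (i n k : nat) : set {poly R} :=
  if i is i'.+1 then
    \big[setU/set0]_(c < k.+1 | (i * c <= n)%N)
      products (powers i (@monics R c)) (strata i' (n - i * c) (k - c))
  else [set f | [/\ n = 0%N, k = 0%N & f = 1]].

(* The truncation of [\sum_m m T ^ m = T / (1 - T) ^ 2]. *)
Definition weights (i : nat) : {poly nat} := \sum_(m < i) (m.+1)%:P * 'X^(m.+1).

(** Binomial expansion that splits off the top term of [weights i.+1]. It mirrors the recursion of
    [strata]: ['C(k, c)] comes from [hilbert_products] and [i.+1 ^ c] from [hilbert_powers]. *)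
Lemma coef_weights_exprS (i n k : nat) :
  (weights i.+1 ^+ k)`_n = \sum_(c < k.+1 | (i.+1 * c <= n)%N)
    ('C(k, c) * i.+1 ^ c)%N * (weights i ^+ (k - c))`_(n - i.+1 * c).
Proof.
rewrite /weights big_ord_recr /= exprDn coef_sum [RHS]big_mkcond /=.
apply: eq_bigr => c _; rewrite coefMn exprMn -exprM mulrCA -rmorphXn /= coefCM coefMXn.
rewrite ltnNge; case: leqP => _ /=; last by rewrite mulr0 mul0rn.
by rewrite -mulr_natl natn -mulrA; congr (_ * (_ * _)).
Qed.

Lemma hilbert_strata (R : realType) (i n k : nat) :
  hilbert_bounded (@strata R i n k) k ((weights i ^+ k)`_n)%R.
Proof.
elim: i n k => [|i IHi] n k.
  rewrite /weights big_ord0; case: k => [|k].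
    case: n => [|n]; rewrite expr0 coef1 /=.
      have [C CP] := hilbert_monics R 0; exists C => s.
      have [I [b [cI bP]]] := CP s; exists I, b; split => // l sl.
      have [c cP] := bP l sl; exists c => f [_ _ ->]; apply: cP.
      by split; rewrite ?monic1 ?size_poly1.
    have [C CP] := hilbert_set0 R 0; exists C => s.
    have [I [b [cI bP]]] := CP s; exists I, b; split => // l sl.
    by have [c cP] := bP l sl; exists c => f [].
  rewrite expr0n coef0.
  have [C CP] := hilbert_set0 R k.+1; exists C => s.
  have [I [b [cI bP]]] := CP s; exists I, b; split => // l sl.
  by have [c cP] := bP l sl; exists c => f [].
rewrite coef_weights_exprS /=.
elim/big_ind2 : _ => [|X a Y a' XP YP|c _]; first exact: hilbert_set0.
  exact: hilbert_setU.
have ck : (c + (k - c) = k)%N by rewrite subnKC // -ltnS.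
have := hilbert_products (hilbert_powers (ltn0Sn i) (hilbert_monics R c))
  (IHi (n - i.+1 * c)%N (k - c)%N).
by rewrite ck mul1n.
Qed.

(** Take for [g_j] the product of the linear factors with exponent [j]; its degree counts the pairs
    of [l] with that exponent. *)
Lemma prod_XsubC_exp_strata (R : realType) (i : nat) (l : seq (R * nat)) :
  all (fun p => 0 < p.2 <= i)%N l ->
  strata i (\sum_(p <- l) p.2) (size l) (\prod_(p <- l) ('X - p.1%:P) ^+ p.2).
Proof.
elim: i l => [|i IHi] l lP.
  case: l lP => [|p l /=]; first by rewrite /= !big_nil.
  by case: p.2.
pose l1 := [seq p <- l | p.2 == i.+1]; pose l2 := [seq p <- l | p.2 != i.+1].
have ll : perm_eq l (l1 ++ l2) by rewrite perm_sym; apply: permEl; apply: perm_filterC.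
have sl : size l = (size l1 + size l2)%N by rewrite (perm_size ll) size_cat.
have s1 : (\sum_(p <- l1) p.2 = i.+1 * size l1)%N.
  rewrite big_filter (eq_bigr (fun=> i.+1)); last by move=> p /eqP.
  by rewrite big_const_seq iter_addn_0 size_filter.
rewrite (perm_big _ ll) /= big_cat s1 sl.
have l1k : (size l1 < (size l1 + size l2).+1)%N by rewrite ltnS leq_addr.
rewrite (bigD1 (Ordinal l1k)) /= ?leq_addr //; left.
rewrite !addKn (perm_big _ ll) /= big_cat.
exists (\prod_(p <- l1) ('X - p.1%:P) ^+ p.2), (\prod_(p <- l2) ('X - p.1%:P) ^+ p.2).
split=> //.
  exists (\prod_(p <- l1) ('X - p.1%:P)).
    by split; rewrite ?monic_prod_XsubC ?size_prod_XsubC.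
  rewrite -prodrXl !big_filter; by apply: eq_bigr => p /eqP ->.
apply: IHi; apply/allP => p; rewrite mem_filter => /andP[pi /(allP lP)/andP[-> h]].
by rewrite -ltnS ltn_neqAle pi.
Qed.

(** * Coefficients of powers of [weights] and binomial estimates *)

Lemma sum_bin_diag (r n : nat) :
  (\sum_(j < n.+1) 'C(j + r, r.*2.+1) = 'C(n + r.+1, r.*2.+2))%N.
Proof.
elim: n => [|n IHn].
  rewrite big_ord1 add0n add0n bin_small ?bin_small // -addnn; lia.
by rewrite big_ord_recr IHn /= [(n.+1 + r)%N]addSnnS [in RHS]addSn binS.
Qed.

Lemma sum_bin_weighted (r n : nat) :
  (\sum_(j < n.+1) 'C(j + r, r.*2.+1) * (n - j) = 'C(n + r.+1, r.*2.+3))%N.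
Proof.
elim: n => [|n IHn].
  by rewrite big_ord1 muln0 bin_small //; rewrite -addnn; lia.
rewrite big_ord_recr /= subnn muln0 addn0 addSn binS -sum_bin_diag -IHn.
rewrite addnC -big_split /=; apply: eq_bigr => j _.
by rewrite subSn ?mulnS // -ltnS.
Qed.

(** For [n <= N] the truncation is invisible, and the value is the coefficient of [T ^ n] in
    [T ^ r.+1 / (1 - T) ^ r.*2.+2]. *)
Lemma coef_weights_expr (N r n : nat) :
  (n <= N)%N -> (weights N ^+ r.+1)`_n = 'C(n + r, r.*2.+1).
Proof.
have coefW m : (m <= N)%N -> (weights N)`_m = m.
  move=> mN; rewrite /weights coef_sum; case: m mN => [|m] mN.
    by rewrite big1 // => j _; rewrite coefCM coefXn mulr0.
  rewrite (bigD1 (Ordinal mN)) //= coefCM coefXn eqxx mulr1 big1 ?addr0 // => j jm.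
  rewrite coefCM coefXn eqSS (_ : (m == j) = false) ?mulr0 //.
  by apply: contraNF jm => /eqP e; apply/eqP/val_inj.
elim: r n => [|r IHr] n nN; first by rewrite expr1 addn0 bin1 coefW.
rewrite exprSr coefM doubleS -sum_bin_weighted; apply: eq_bigr => j _.
rewrite IHr ?coefW //; first by rewrite (leq_trans (leq_subr _ _)).
by rewrite (leq_trans _ nN) // -ltnS.
Qed.

Lemma fact_divS (m r : nat) : (r <= m)%N ->
  (m.+1`! %/ r`! = m.+1 * (m`! %/ r`!))%N.
Proof.
by move=> rm; rewrite factS muln_divA // -(bin_fact rm) dvdn_mull ?dvdn_mulr.
Qed.

(** Both bounds below compare growth ratios in [m], starting from [m = r], where all sides equal 1.
    This is the ratio of the left-hand side. *)
Lemma bin_addS (m r : nat) : (r <= m)%N ->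
  ((m.+1 - r) * 'C(m.+2 + r, r.*2.+1) = (m.+2 + r) * 'C(m.+1 + r, r.*2.+1))%N.
Proof.
move=> rm; have -> : (m.+1 - r = (m.+1 + r).+1 - r.*2.+1)%N by rewrite -addnn; lia.
by rewrite addSn mul_bin_down.
Qed.

Lemma bin_leq_expn_fact (r m : nat) : (r <= m)%N ->
  ('C(m.+1 + r, r.*2.+1) <= 2 ^ (m - r) * (m`! %/ r`!))%N.
Proof.
elim: m => [|m IHm]; first by rewrite leqn0 => /eqP ->.
rewrite leq_eqVlt => /predU1P[<-|].
  by rewrite subnn divnn fact_gt0 addSn addnn binn.
rewrite ltnS => rm; have m0 : (0 < m.+1 - r)%N by rewrite subn_gt0 ltnS.
rewrite -(leq_pmul2l m0) bin_addS // fact_divS // subSn // expnS.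
apply: leq_trans (leq_mul (leqnn _) (IHm rm)) _.
move: (2 ^ _)%N (_ %/ _)%N => a b.
suff : (m.+2 + r <= (m - r).+1 * (2 * m.+1))%N.
  by move/(leq_mul (leqnn (a * b)%N)); nia.
by nia.
Qed.

Lemma bin_leq_bin_fact (r m : nat) : (r <= m)%N ->
  ('C(m.+1 + r, r.*2.+1) <= 'C(m.+1, r.+1) * (m`! %/ r`!))%N.
Proof.
elim: m => [|m IHm]; first by rewrite leqn0 => /eqP ->.
rewrite leq_eqVlt => /predU1P[<-|].
  by rewrite binn divnn fact_gt0 addSn addnn binn.
rewrite ltnS => rm; have m0 : (0 < m.+1 - r)%N by rewrite subn_gt0 ltnS.
rewrite -(leq_pmul2l m0) bin_addS // fact_divS // mulnA -subSS -mul_bin_down.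
apply: leq_trans (leq_mul (leqnn _) (IHm rm)) _.
rewrite /=; move: 'C(_, _) (_ %/ _)%N => a b.
suff : (m.+2 + r <= m.+2 * m.+1)%N by move/(leq_mul (leqnn (a * b)%N)); nia.
by nia.
Qed.

(** * Hyperbolic polynomials *)

Section FPoly.
Variables (R : realType) (n : nat).
Implicit Type z : 'rV[R]_n.

(* The linear part of the affine map [fpoly]. *)
Definition fdir z : {poly R} :=
  \sum_(i < n) ((-1) ^+ i.+1 * z 0 i) *: 'X^(n - i.+1).

Lemma fpolyE z : fpoly z = 'X^n + fdir z.
Proof. by []. Qed.

Lemma coef_fdir z (i : 'I_n) : (fdir z)`_(n - i.+1) = (-1) ^+ i.+1 * z 0 i.
Proof.
rewrite coef_sum (bigD1 i) //= coefZ coefXn eqxx mulr1 big1 ?addr0 // => j ji.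
rewrite coefZ coefXn (_ : (_ == _) = false) ?mulr0 //.
apply: contraNF ji => /eqP e; apply/eqP/val_inj => /=.
by have := ltn_ord i; have := ltn_ord j; lia.
Qed.

Lemma size_fdir z : (size (fdir z) <= n)%N.
Proof.
apply/leq_sizeP => j nj; rewrite coef_sum big1 // => i _.
rewrite coefZ coefXn (_ : (_ == _) = false) ?mulr0 //.
by have := ltn_ord i; lia.
Qed.

Lemma fdirP (p : {poly R}) : (size p <= n)%N ->
  fdir (\row_i ((-1) ^+ i.+1 * p`_(n - i.+1))) = p.
Proof.
move=> sp; apply/polyP => j; have [nj|jn] := leqP n j.
  by rewrite !nth_default // (leq_trans _ nj) // size_fdir.
have lt : (n - j.+1 < n)%N by lia.
have -> : j = (n - (Ordinal lt).+1)%N by rewrite /=; lia.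
by rewrite coef_fdir mxE mulrA -expr2 sqrr_sign mul1r.
Qed.

Lemma fpoly_monics z : monics n (fpoly z).
Proof.
have sz : (size (fdir z) < size ('X^n : {poly R}))%N.
  by rewrite size_polyXn ltnS size_fdir.
split; first by rewrite fpolyE monicE lead_coefDl // lead_coefXn.
by rewrite fpolyE size_polyDl // size_polyXn.
Qed.

Lemma coef_fpoly z (i : 'I_n) :
  z 0 i = (-1) ^+ i.+1 * (fpoly z)`_(n - i.+1).
Proof.
rewrite fpolyE coefD coefXn coef_fdir (_ : (_ == _) = false); last first.
  by have := ltn_ord i; lia.
by rewrite add0r mulrA -expr2 sqrr_sign mul1r.
Qed.

Lemma fpolyD z (w : 'rV[R]_n) (e : R) : fpoly (z + e *: w) = fpoly z + e *: fdir w.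
Proof.
rewrite !fpolyE -addrA; congr (_ + _); rewrite /fdir scaler_sumr -big_split /=.
by apply: eq_bigr => i _; rewrite !mxE scalerA -scalerDl; congr (_ *: _); ring.
Qed.

End FPoly.

Lemma only_real_roots_prod (R : realType) (rs : seq R) :
  only_real_roots (\prod_(x <- rs) ('X - x%:P)).
Proof.
move=> w; rewrite rmorph_prod /=.
under eq_bigr do rewrite rmorphB /= map_polyX map_polyC /=.
rewrite -(big_map (real_complex R) xpredT (fun x => 'X - x%:P)) root_prod_XsubC.
by move=> /mapP[x _ ->].
Qed.

Lemma only_real_rootsP (R : realType) (p : {poly R}) :
  p \is monic -> only_real_roots p ->
  exists rs : seq R, p = \prod_(x <- rs) ('X - x%:P).
Proof.
move=> p1 pr; have [r rE] := closed_field_poly_normal (map_poly (real_complex R) p).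
have /monicP lc : map_poly (real_complex R) p \is monic by rewrite map_monic.
rewrite lc scale1r in rE.
exists (map (@complex.Re R) r); apply: (map_poly_inj (real_complex R)).
rewrite [LHS]rE rmorph_prod /= big_map; apply: eq_big_seq => z zr.
rewrite rmorphB /= map_polyX map_polyC /=; congr ('X - _%:P).
have := pr z; rewrite rE root_prod_XsubC => /(_ zr).
by case: z {zr} => a b /= ->.
Qed.

(** The strata ask for exactly [k] pairs, so a multiple root may be split over several pairs when
    there are fewer than [k] distinct roots. If [k] is the number of roots, all exponents are 1;
    otherwise a repeated root raises the exponent of an existing pair and a new root opens one. *)
Lemma multiplicity_list (R : realType) (rs : seq R) (k : nat) :
  (size (undup rs) <= k)%N -> (k <= size rs)%N ->
  exists l : seq (R * nat), [/\ size l = k, all (fun p => 0 < p.2)%N l,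
    (\sum_(p <- l) p.2 = size rs)%N &
    \prod_(p <- l) ('X - p.1%:P) ^+ p.2 = \prod_(x <- rs) ('X - x%:P)].
Proof.
elim: rs k => [|x rs IHrs] k.
  by rewrite leqn0 => _ /eqP ->; exists [::]; split; rewrite ?big_nil.
move=> du; rewrite [size (x :: rs)]/= leq_eqVlt => /predU1P[->|].
  exists [seq (y, 1%N) | y <- x :: rs]; split.
  - by rewrite size_map.
  - by rewrite all_map; apply/allP.
  - by rewrite big_map sum1_size.
  by rewrite big_map.
rewrite ltnS => kn; move: du => /=; case: ifP => [xrs du|xrs /= du].
  have [l [sl l0 ln lE]] := IHrs k du kn.
  have : root (\prod_(p <- l) ('X - p.1%:P) ^+ p.2) x by rewrite lE root_prod_XsubC.
  rewrite rootE horner_prod prodf_seq_eq0 => /hasP[[y m] yml] /=.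
  rewrite horner_exp hornerXsubC expf_eq0 subr_eq0 => /andP[m0 /eqP xy].
  rewrite -{}xy in yml.
  exists ((x, m.+1) :: rem (x, m) l); split.
  - by rewrite /= size_rem // prednK //; case: (l) yml.
  - by apply/allP => p; rewrite inE => /predU1P[->//|/mem_rem/(allP l0)].
  - by rewrite big_cons -ln (big_rem _ yml).
  by rewrite !big_cons -lE [in RHS](big_rem _ yml) /= exprS mulrA.
case: k du kn => // k; rewrite ltnS => du /ltnW kn.
have [l [sl l0 ln lE]] := IHrs k du kn.
exists ((x, 1%N) :: l); split.
- by rewrite /= sl.
- by rewrite /= l0.
- by rewrite big_cons ln.
by rewrite !big_cons lE expr1.
Qed.

Lemma finite_pos_lb (R : realType) (s : seq R) :
  all (fun x => 0 < x) s -> exists2 e, 0 < e & all (fun x => e <= x) s.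
Proof.
elim: s => [_|x s IHs /= /andP[x0 /IHs[e e0 es]]]; first by exists 1.
exists (Num.min x e); first by rewrite lt_min x0.
rewrite ge_min lexx /=; apply/allP => y /(allP es) ey.
by rewrite ge_min ey orbT.
Qed.

Lemma mulr_lt0_perturb (R : realFieldType) (a b c d : R) :
  a * b < 0 -> `|c| < `|a| -> `|d| < `|b| -> (a + c) * (b + d) < 0.
Proof.
rewrite !ltr_norml; case: (ltrgtP a 0) => [a0|a0|->]; last by rewrite mul0r ltxx.
  rewrite nmulr_rlt0 // => b0; rewrite (ltr0_norm a0) (gtr0_norm b0).
  by move=> /andP[? ?] /andP[? ?]; rewrite nmulr_rlt0; lra.
rewrite pmulr_rlt0 // => b0; rewrite (gtr0_norm a0) (ltr0_norm b0).
by move=> /andP[? ?] /andP[? ?]; rewrite pmulr_rlt0; lra.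
Qed.

Lemma perturb_simple_roots (R : realType) (rs : seq R) (q : {poly R}) :
  uniq rs -> (size q <= size rs)%N ->
  exists2 e : R, 0 < e & forall t, `|t| < e -> exists rs' : seq R,
    \prod_(x <- rs) ('X - x%:P) + t *: q = \prod_(x <- rs') ('X - x%:P).
Proof.
move=> urs sq; set g := \prod_(x <- rs) _.
(* [g] changes sign around each of its simple roots, and keeps doing so after
   a perturbation that is small at the points [x - h] and [x + h]. *)
pose D := [seq `|x - y| / 3 | x <- rs, y <- rs].
have [|h h0 hD] := @finite_pos_lb R [seq d <- D | 0 < d].
  by apply/allP => d; rewrite mem_filter => /andP[].
have gap x y : x \in rs -> y \in rs -> x != y -> 3 * h <= `|x - y|.
  move=> xr yr xy.
  have : `|x - y| / 3 \in [seq d <- D | 0 < d].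
    rewrite mem_filter divr_gt0 ?normr_gt0 ?subr_eq0 //=.
    by apply/allpairsP; exists (x, y).
  by move=> /(allP hD) /=; lra.
have gsign x : x \in rs -> g.[x - h] * g.[x + h] < 0.
  move=> xr; rewrite /g !horner_prod -big_split /= (big_rem _ xr) /=.
  rewrite !hornerXsubC nmulr_rlt0; last first.
    by rewrite (_ : _ * _ = - h ^+ 2) ?oppr_lt0 ?exprn_gt0 //; ring.
  rewrite big_seq prodr_gt0 // => y yr; rewrite !hornerXsubC.
  have /andP[yx yrs] : (y != x) && (y \in rs) by move: yr; rewrite mem_rem_uniq.
  have := gap x y xr yrs; rewrite eq_sym => /(_ yx).
  have -> : (x - h - y) * (x + h - y) = `|x - y| ^+ 2 - h ^+ 2.
    by rewrite real_normK ?num_real //; ring.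
  move: `|x - y| => d hd; rewrite subr_gt0 ltr_pXn2r ?nnegrE //; lra.
pose pts := [seq x - h | x <- rs] ++ [seq x + h | x <- rs].
(* The ratios in [E] bound [t] so that [t *: q] stays below [g] in absolute value at the test
   points; the summand 1 avoids division by zero. *)
pose E := [seq `|g.[y]| / (1 + `|q.[y]|) | y <- pts].
have [|e e0 eE] := @finite_pos_lb R E.
  apply/allP => _ /mapP[y yp ->]; rewrite divr_gt0 ?ltr_pwDl // normr_gt0.
  move: yp; rewrite mem_cat => /orP[] /mapP[x xr ->]; have := gsign x xr.
    by apply: contraTneq => ->; rewrite mul0r ltxx.
  by apply: contraTneq => ->; rewrite mulr0 ltxx.
exists e => // t te.
have small y : y \in pts -> `|t * q.[y]| < `|g.[y]|.
  move=> yp; have := allP eE _ (map_f _ yp); rewrite /= ler_pdivlMr ?ltr_pwDl //.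
  apply: lt_le_trans; rewrite normrM.
  by have := normr_ge0 q.[y]; have := normr_ge0 t; move: te; nra.
set p := g + t *: q.
have psign x : x \in rs -> p.[x - h] * p.[x + h] < 0.
  move=> xr; rewrite !hornerD !hornerZ; apply: mulr_lt0_perturb (gsign x xr) _ _.
    by apply: small; rewrite mem_cat (map_f (fun x => x - h)).
  by apply: small; rewrite mem_cat (map_f (fun x => x + h)) ?orbT.
have : forall x, exists y, x \in rs -> `|y - x| < h /\ root p y.
  move=> x; have [xr|] := boolP (x \in rs); last by exists 0.
  have xh : x - h <= x + h by lra.
  have [y /andP[y1 y2] py] := polyrcf.poly_ivtoo xh (psign x xr).
  by exists y => _; split => //; rewrite ltr_norml; rewrite !bnd_simp in y1 y2; lra.
move=> /choice[r rP]; exists (map r rs).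
have sg : size g = (size rs).+1 by rewrite size_prod_XsubC.
have stq : (size (t *: q) < size g)%N.
  by rewrite sg ltnS (leq_trans (size_scale_leq _ _)).
(* There is one root of [p] within [h] of each element of [rs]. These elements are at least [3 * h]
   apart, so the new roots are distinct, and they are as many as the degree of [p]. *)
rewrite [LHS](@all_roots_prod_XsubC _ p (map r rs)).
- by rewrite lead_coefDl // (monicP (monic_prod_XsubC _ _ _)) scale1r.
- by rewrite size_polyDl // sg size_map.
- by rewrite all_map; apply/allP => x /rP[].
rewrite uniq_rootsE map_inj_in_uniq // => x y xr yr rxy.
apply/eqP; apply: contraT => /(gap x y xr yr).
have [] := rP x xr; have [] := rP y yr.
rewrite rxy !ltr_norml => /andP[? ?] _ /andP[? ?] _.
by rewrite ler_normr => /orP[]; lra.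
Qed.

(** * Local extreme points *)

Lemma leq_size_card_le_II (T : choiceType) (A : set T) (M : nat) (s : seq T) :
  A #<= `I_M -> uniq s -> (forall x, x \in s -> A x) -> (size s <= M)%N.
Proof.
move=> AM us sA; have Afin : finite_set A by apply/finite_set_leP; exists M.
apply: leq_trans (geq_card_fset_set AM); apply: uniq_leq_size => // x /sA Ax.
by rewrite in_fset_set // inE.
Qed.

Lemma card_le_II_seq (T : choiceType) (A : set T) (M : nat) :
  (forall s : seq T, uniq s -> (forall x, x \in s -> A x) -> (size s <= M)%N) ->
  A #<= `I_M.
Proof.
move=> AM; have Afin : finite_set A.
  apply: contrapT => Ainf.
  have [s [us sA sM]] : exists s : seq T,
      [/\ uniq s, forall x, x \in s -> A x & size s = M.+1].
    elim: M.+1 => [|m [s [us sA sm]]]; first by exists [::].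
    have [x [Ax xs]] : exists x, A x /\ x \notin s.
      apply: contrapT => h; apply: Ainf.
      apply: (@sub_finite_set _ _ [set` s]); last exact: finite_seq.
      by move=> x Ax /=; apply: contrapT => /negP xs; apply: h; exists x.
    exists (x :: s); split; rewrite /= ?xs ?sm // => y.
    by rewrite inE => /predU1P[->|/sA].
  by have := AM s us sA; rewrite sM ltnn.
have /finite_setP[m Am] := Afin.
rewrite (card_le_eql Am) card_le_II.
move: Am; rewrite card_eq_le => /andP[_ /(leq_card_fset_set Afin)].
move=> /leq_trans; apply; apply: AM => [|x]; first exact: finmap.fset_uniq.
by rewrite in_fset_set // inE.
Qed.

Lemma hyperbolic_roots (R : realType) (n : nat) (z : 'rV[R]_n) : hyperbolic z ->
  exists2 rs : seq R, size rs = n & fpoly z = \prod_(x <- rs) ('X - x%:P).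
Proof.
move=> hz; have [z1 sz] := fpoly_monics z.
have [rs rsE] := only_real_rootsP z1 hz; exists rs => //.
by move: sz; rewrite rsE size_prod_XsubC => -[].
Qed.

Lemma hyperbolic_stratum_strata (R : realType) (n k : nat) (z : 'rV[R]_n) :
  (k <= n)%N -> hyperbolic_stratum k z -> strata n n k (fpoly z).
Proof.
move=> kn [hz zk]; have [rs srs zE] := hyperbolic_roots hz.
have du : (size (undup rs) <= k)%N.
  apply: (leq_size_card_le_II zk (undup_uniq rs)) => x.
  by rewrite mem_undup /= zE root_prod_XsubC.
rewrite -srs in kn; have [l [<- l0 ln lE]] := multiplicity_list du kn.
rewrite zE -lE -{2}srs -ln; apply: prod_XsubC_exp_strata.
apply/allP => p pl; rewrite (allP l0 p pl) -srs -ln (big_rem p pl) /=.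
exact: leq_addr.
Qed.

Lemma kernel_perturbation (R : realType) (n k : nat)
    (L : {linear 'rV[R]_n -> 'rV[R]_k})
    (rs rt : seq R) :
  (k < size rs)%N -> (size rs + size rt)%N = n ->
  exists (w : 'rV[R]_n) (q : {poly R}), [/\ w != 0, L w = 0, (size q <= size rs)%N &
    fdir w = q * \prod_(x <- rt) ('X - x%:P)].
Proof.
move=> kd dn; set d := size rs in kd dn *; set h := \prod_(x <- rt) _.
have sh : size h = (size rt).+1 by rewrite size_prod_XsubC.
have h0 : h != 0 by rewrite -size_poly_eq0 sh.
(* Row [j] of [W] is the vector whose [fdir] is ['X^j * h]. Its image under [L] has [k < d]
   coordinates, so some nonzero combination of the rows is killed. *)
pose W : 'M[R]_(d, n) :=
  \matrix_(j, i) ((-1) ^+ i.+1 * ('X^j * h)`_(n - i.+1)).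
have : kermx (W *m lin1_mx L) != 0.
  rewrite -mxrank_eq0 mxrank_ker subn_eq0 -ltnNge.
  exact: leq_ltn_trans (rank_leq_col _) kd.
move=> /rowV0Pn[v /sub_kermxP vW v0].
have sv : (size (rVpoly v) <= d)%N by apply: size_poly.
have fW : fdir (v *m W) = rVpoly v * h.
  rewrite -[RHS](@fdirP _ n).
    congr fdir; apply/rowP => i; rewrite !mxE.
    rewrite /rVpoly poly_def mulr_suml coef_sum mulr_sumr.
    apply: eq_bigr => j _; rewrite mxE -scalerAl coefZ.
    by rewrite (valK j : insub _ = Some j); ring.
  rewrite (leq_trans (size_polyMleq _ _)) // sh addnS /= -dn leq_add2r //.
exists (v *m W), (rVpoly v); split => //.
  apply: contra_neq v0 => vW0; apply/(can_inj (@rVpolyK _ _)); rewrite linear0.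
  apply/eqP; have := fW; rewrite vW0 => /esym/eqP.
  rewrite [X in _ == X](_ : _ = 0) ?mulf_eq0 ?(negbTE h0) ?orbF //.
  by rewrite /fdir big1 // => i _; rewrite mxE mulr0 scale0r.
by rewrite -mul_rV_lin1 -mulmxA.
Qed.

Lemma local_extreme_sub_boundary (R : realType) (n k : nat)
    (L : {linear 'rV[R]_n -> 'rV[R]_k}) (a : 'rV[R]_k) :
  local_extreme_points (hyperbolic_slice L a) `<=` slice_boundary k L a.
Proof.
move=> z [[hz za] [U [Uz [_ ext]]]]; split => //; split => //.
have [rs srs zE] := hyperbolic_roots hz.
have [du|kd] := leqP (size (undup rs)) k.
  apply: card_le_II_seq => s us sr; apply: leq_trans du; apply: uniq_leq_size => // x.
  by move=> /sr; rewrite /= zE root_prod_XsubC mem_undup.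
(* [undup rs] gives the squarefree factor with every root once, and [rt] the roots of the cofactor,
   which stays fixed. *)
have [rt rsE] := perm_to_subseq (undup_subseq rs).
have dn : (size (undup rs) + size rt)%N = n by rewrite -srs (perm_size rsE) size_cat.
have [w [q [w0 Lw sq wE]]] := kernel_perturbation L kd dn.
have [e e0 eP] := perturb_simple_roots (undup_uniq rs) sq.
have slice t : `|t| < e -> hyperbolic_slice L a (z + t *: w).
  move=> /eP[rs' rs'E]; split.
    rewrite /hyperbolic /=.
    have -> : fpoly (z + t *: w) = \prod_(x <- rs' ++ rt) ('X - x%:P).
      rewrite fpolyD zE (perm_big _ rsE) /= !big_cat /= wE -rs'E.
      by rewrite mulrDl scalerAl.
    exact: only_real_roots_prod.
  by rewrite /= linearD linearZ /= Lw scaler0 addr0.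
have [r /= r0 rU] := (nbhs_ballP z U).1 Uz.
pose B := \sum_j `|w 0 j|.
have B0 : 0 <= B by apply: sumr_ge0.
have inU t : `|t| * B < r -> U (z + t *: w).
  move=> tB; apply: rU; split=> // i j; rewrite ord1 /ball /= !mxE.
  rewrite opprD addNKr normrN normrM (le_lt_trans _ tB) // ler_wpM2l //.
  by rewrite /B (bigD1 j) //= lerDl sumr_ge0.
(* [B] bounds the coordinates of [w], so the second term of the minimum keeps [z + t *: w] and
   [z - t *: w] in [U]; halving makes the inequalities strict. *)
pose t := Num.min e (r / (1 + B)) / 2.
have [t0 te tr] : [/\ 0 < t, t < e & t * B < r].
  have m0 : 0 < Num.min e (r / (1 + B)).
    by rewrite lt_min e0 divr_gt0 // ltr_pwDl.
  have m1 : Num.min e (r / (1 + B)) <= e by rewrite ge_min lexx.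
  have : Num.min e (r / (1 + B)) <= r / (1 + B) by rewrite ge_min lexx orbT.
  rewrite ler_pdivlMr ?ltr_pwDl // => m2; rewrite /t.
  by split; [lra | lra | move: m0 m1 m2; move: (Num.min _ _) => m; nra].
have hull s : `|s| = t -> convex_hull (hyperbolic_slice L a `&` U) (z + s *: w).
  by move=> st; apply: sub_gen_smallest; split; [apply: slice | apply: inU]; rewrite st.
have [|||||xz _] := ext (z + t *: w) (z + (- t) *: w) 2^-1.
- by apply: hull; rewrite gtr0_norm.
- by apply: hull; rewrite normrN gtr0_norm.
- by rewrite invr_gt0.
- by lra.
- by apply/rowP => j; rewrite !mxE; lra.
have : t *: w = 0 by apply: (addrI z); rewrite xz addr0.
by move=> /eqP; rewrite scaler_eq0 (negbTE w0) orbF gt_eqF.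
Qed.

(** * Asymptotic comparison and the generic count *)

Lemma expnS_leq (q k : nat) : (0 < q)%N ->
  (q * q.+1 ^ k + q ^ k <= q ^ k * (q + 2 ^ k))%N.
Proof.
move=> q0; elim: k => [|k IHk]; first by rewrite !expn0; lia.
have : (0 < 2 ^ k)%N by rewrite expn_gt0.
move: IHk; rewrite !expnS; move: (q.+1 ^ k)%N (q ^ k)%N (2 ^ k)%N => x y p IHk p0.
have : (y * (p + q) <= y * (p * q + 1))%N by rewrite leq_mul2l; apply/orP; right; nia.
nia.
Qed.

(** Both sides grow like [s ^ k], with leading coefficients [a] and [a.+1]. This makes the products
    of forms outnumber the dimension of the space they lie in. *)
Lemma expn_dominated (a c k : nat) : (0 < k)%N ->
  exists s, (a * (s + c) ^ k < a.+1 * s.+1 ^ k)%N.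
Proof.
move=> k0; have [->|c0] := posnP c.
  by exists 0; rewrite exp0n // muln0 exp1n.
(* With [s = c * q] the ratio of [s + c] to [s] is [1 + 1/q], whose [k]-th power is at most
   [1 + (2 ^ k - 1)/q] by [expnS_leq]; this [q] brings it below [(a + 1)/a] for positive [a]. *)
pose q := (a * 2 ^ k).+1; exists (c * q)%N.
have qP : (a * q.+1 ^ k < a.+1 * q ^ k)%N.
  have := expnS_leq k (ltn0Sn (a * 2 ^ k)); rewrite -/q.
  have : (0 < q ^ k)%N by rewrite expn_gt0.
  have : (q = (a * 2 ^ k).+1)%N by [].
  move: (q.+1 ^ k)%N (q ^ k)%N (2 ^ k)%N => x y p qE y0 h.
  rewrite -(ltn_pmul2l (ltn0Sn (a * 2 ^ k))) -/q.
  have := leq_mul (leqnn a) h; nia.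
rewrite [(c * q + c)%N]addnC -mulnS expnMn mulnCA.
apply: leq_trans (_ : c ^ k * (a.+1 * q ^ k) <= _)%N.
  by rewrite ltn_pmul2l // expn_gt0 c0.
by rewrite mulnCA -expnMn leq_mul2l leq_exp2r // leqnSn orbT.
Qed.

Lemma hilbert_bounded_slice (R : realType) (n k a : nat) (X : set {poly R}) :
  (0 < k)%N -> hilbert_bounded X k a ->
  exists2 q : mpoly (n * k + k) R, q != 0 &
    forall (A : 'M[R]_(n, k)) b, meval (row_mx (mxvec A) b 0) q != 0 ->
      [set z | X (fpoly z) /\ z *m A = b] #<= `I_a.
Proof.
move=> k0 [C XP].
(* The shift by [a] accounts for working in degree [s + a]: up to [s] for the powers of [L z] and up
   to [a] for [theta]. *)
have [s sP] := expn_dominated a (a + C) k0; rewrite addnA in sP.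
have [I [b [cI bP]]] := XP (s + a)%N.
have HM : (#|I| < a.+1 * 'C(k + s, k))%N.
  rewrite -(ltn_pmul2l (fact_gt0 k)); apply: (leq_ltn_trans cI).
  apply: (leq_trans sP); rewrite mulnCA leq_mul2l [(k`! * _)%N]mulnC bin_ffact.
  by rewrite expn_leq_ffact orbT.
pose Y : set 'rV[R]_n := [set z | X (fpoly z)].
pose d (h : 'I_#|I|) (z : 'rV[R]_n) := b (enum_val h) (fpoly z).
have [|q q0 qP] := @generic_slice_card R n k s a #|I| Y d _ HM.
  (* Coordinates of [z] are coefficients of [fpoly z] up to sign. Padding with the index [n], where
     the coefficient is 1, makes the length exactly [s + a]. *)
  move=> l sl; pose l' := [seq (n - i.+1)%N | i <- map val l] ++ nseq (s + a - size l) n.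
  have [|c cP] := bP l'; first by rewrite size_cat !size_map size_nseq subnKC.
  exists (fun h => (\prod_(i <- l) (-1) ^+ i.+1) * c (enum_val h)) => z Xz.
  transitivity ((\prod_(i <- l) (-1) ^+ i.+1) * \prod_(j <- l') (fpoly z)`_j).
    rewrite big_cat !big_map /= [X in _ * (_ * X)]big_nseq iter_mulr_1.
    have -> : (fpoly z)`_n = 1.
      by have [/monicP z1 sz] := fpoly_monics z; move: z1; rewrite lead_coefE sz.
    rewrite expr1n mulr1 -big_split /=.
    by apply: eq_bigr => i _; apply: coef_fpoly.
  rewrite cP // mulr_sumr (reindex (@enum_val I I)) /=; last first.
    by apply: onW_bij; apply: enum_val_bij.
  by apply: eq_bigr => h _; rewrite mulrA.
exists q => // A v qv; apply: card_le_II_seq => zs uzs zsP.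
exact: qP qv _ uzs zsP.
Qed.

Theorem theorem2p14 (R : realType) (n k : nat) (k_ge1 : (1 <= k)%N)
    (k_len : (k <= n)%N) :
  @generically R n k (fun L a =>
    range L = [set: 'rV[R]_k] ->
    [/\ finite_set (slice_boundary k L a),
        finite_set (local_extreme_points (hyperbolic_slice L a)) &
        local_extreme_points (hyperbolic_slice L a)
          #<= `I_(minn (2 ^ (n - k) * ((n.-1)`! %/ (k.-1)`!))
                    ('C(n, k) * ((n.-1)`! %/ (k.-1)`!)))]).
Proof.
have [q q0 qP] := hilbert_bounded_slice n k_ge1 (hilbert_strata R n n k).
exists [set v | meval (fun i => v 0 i) q = 0]; split.
- by exists [set q]; apply/seteqP; split => [v qv p ->|v /(_ q erefl)].
- have [v vP] := meval_neq0_ex q0.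
  move=> VT; have : [set v : 'rV[R]_(n * k + k) | meval (fun i => v 0 i) q = 0]
    (\row_i v i) by rewrite VT.
  move=> /= qv; move/eqP: vP; apply; rewrite -[RHS]qv.
  by apply: meval_eq => i; rewrite mxE.
move=> L a La _.
have bound : slice_boundary k L a #<= `I_(((weights n ^+ k)`_n)%R).
  apply: card_le_trans (qP (lin1_mx L) a _); last by apply/eqP.
  apply: subset_card_le => z [zk za]; split; first exact: hyperbolic_stratum_strata.
  by rewrite mul_rV_lin1.
have ext := subset_card_le (@local_extreme_sub_boundary R n k L a).
have ext_bound := card_le_trans ext bound.
split; first by apply/finite_set_leP; eexists; apply: bound.
  by apply/finite_set_leP; eexists; apply: ext_bound.
apply: card_le_trans ext_bound _; rewrite card_le_II.
case: k k_ge1 k_len {q q0 qP L a La bound ext} => // r _ rn.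
(* With [n = m.+1] and [k = r.+1] the count becomes ['C(m.+1 + r, r.*2.+1)]. *)
case: n rn => // m rm; rewrite coef_weights_expr // leq_min.
by rewrite bin_leq_expn_fact ?bin_leq_bin_fact.
Qed.
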